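(* Let $h,z$ be non-identity elements of a bi-ordered group $G$ and suppose that $w(h,z)=1$ in $G$, where $w=w(x,t)$ is a tidy word in the free group on $x,t$. Then the polynomial $A_w(X)\in\mathbb{Z}[X]$ has a positive real root.
   Context: A bi-order on a group $G$ is a total order $<$ such that $u<v$ implies $ux<vx$ and $xu<xv$ for all $u,v,x\in G$; a bi-ordered group is a group equipped with a bi-order. Write $a^b=b^{-1}ab$. Let $F$ be the free group on $x,t$ and $N$ the normal subgroup of $F$ generated by $x$; $N'$ is its derived subgroup. Let $w\in F$ be a non-identity element with exponent sum of $t$ equal to zero. Then $w\in N$ and $w$ is given by an expression $$w=(x^{m_1})^{t^{d_1}}\cdots (x^{m_r})^{t^{d_r}}$$ with $r\ge 1$ and integers $d_i,m_i$. For $j\in\mathbb{Z}$ let $\tau_j(w)=\{i\mid d_i=j\}$ (with respect to this expression) and $S_w=\{j\mid \sum_{i\in\tau_j(w)}m_i\ne 0\}$; $S_w=\emptyset$ if and only if $w\in N'$. If $w\in N\setminus N'$, let $e_w$ and $d_w$ be the smallest and largest elements of $S_w$, and let $A_w(X)=\sum_{i=1}^r m_iX^{d_i-e_w}$, a polynomial in $\mathbb{Z}[X]$ with non-zero constant coefficient. The word $w$ is tidy if $w\in N\setminus N'$ and $\tau_j(w)=\emptyset$ for all $j>d_w$ and all $j<e_w$. The notation $w(h,z)$ means the result of substituting $h$ for $x$ and $z$ for $t$. *)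

(* Defs.v *)
From HB Require Import structures.
From mathcomp Require Import all_boot all_order all_algebra.
From mathcomp Require Import classical_sets reals.

Set Implicit Arguments.
Unset Strict Implicit.
Unset Printing Implicit Defensive.

Import Order.TTheory GRing.Theory Num.Theory.

Local Open Scope group_scope.
Local Open Scope classical_set_scope.

HB.mixin Record Group_isBiOrdered (d : Order.disp_t) G
    of Group G & Order.Total d G := {
  ltg_mul2r : forall x u v : G, (u < v)%O -> (u * x < v * x)%O;
  ltg_mul2l : forall x u v : G, (u < v)%O -> (x * u < x * v)%O
}.

#[short(type="biOrderedGroupType")]
HB.structure Definition BiOrderedGroup (d : Order.disp_t) :=
  { G of Group_isBiOrdered d G & Group G & Order.Total d G }.

Definition zexpg (G : groupType) (g : G) (n : int) : G :=
  match n with Posz k => g ^+ k | Negz k => g ^- k.+1 end.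

Section Subgroups.
Variable G : groupType.
Implicit Types A H : set G.

Definition is_subgroup H := H 1 /\ forall u v, H u -> H v -> H (u * v^-1).

Definition is_normal_subgroup H :=
  is_subgroup H /\ forall u v, H u -> H (u ^ v).

Definition normal_closure A : set G := smallest is_normal_subgroup A.

Definition derived_subgroup H : set G :=
  smallest is_subgroup [set g | exists u v, [/\ H u, H v & g = [~ u, v]]].

End Subgroups.

(* The free group on a type T of generators: freely reduced words, where the
   letter (a, false) stands for the generator a and (a, true) for its inverse. *)
Section FreeReduction.
Variable T : choiceType.
Implicit Types (a b : T * bool) (s u v : seq (T * bool)).

Definition letter_inv a := (a.1, ~~ a.2).

Definition reduced s := sorted (fun a b => b != letter_inv a) s.

Definition cons_red a s :=
  if s is b :: s' then if b == letter_inv a then s' else a :: s else [:: a].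

Definition reduce s := foldr cons_red [::] s.

Definition word_inv s := rev (map letter_inv s).

Lemma letter_invK : involutive letter_inv.
Proof. by case=> a b; rewrite /letter_inv /= negbK. Qed.

Lemma reduced_cons_red a s : reduced s -> reduced (cons_red a s).
Proof.
case: s => [//|b s] /=; case: eqP => [_|/eqP ba] bs; first exact: path_sorted bs.
by rewrite /= ba.
Qed.

Lemma reduced_foldr s u : reduced u -> reduced (foldr cons_red u s).
Proof. by move=> ru; elim: s => //= a s IHs; exact: reduced_cons_red. Qed.

Lemma reduced_reduce s : reduced (reduce s).
Proof. exact: reduced_foldr. Qed.

Lemma cons_redK a s : reduced s -> cons_red (letter_inv a) (cons_red a s) = s.
Proof.
case: s => [_|b s] /=; first by rewrite letter_invK eqxx.
case: eqP => [->|_] bs; last by rewrite /= letter_invK eqxx.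
by case: s bs => //= c s /andP[/negPf-> _].
Qed.

Lemma foldr_reduce s u :
  reduced u -> foldr cons_red u (reduce s) = foldr cons_red u s.
Proof.
move=> ru; elim: s => //= a s <-; move: (reduce s) => [//|b v] /=.
case: eqP => //= ->; rewrite -{1}[a]letter_invK cons_redK //.
exact: reduced_foldr.
Qed.

Lemma reduce_id s : reduced s -> reduce s = s.
Proof.
elim: s => //= a [//|b s] IHs /= /andP[/negPf ba bs].
by move: (IHs bs) => /= ->; rewrite /= ba.
Qed.

Lemma reduce_cat s u : reduce (s ++ u) = foldr cons_red (reduce u) s.
Proof. by rewrite /reduce foldr_cat. Qed.

Lemma reduced_inv s : reduced s -> reduced (word_inv s).
Proof.
rewrite /reduced /word_inv rev_sorted sorted_map.
apply: sub_sorted => a b /=; apply: contra; rewrite letter_invK => /eqP ab.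
by rewrite ab eqxx.
Qed.

Lemma reduce_mulV s : reduced s -> reduce (word_inv s ++ s) = [::].
Proof.
move=> rs; rewrite reduce_cat reduce_id // /word_inv.
elim: s {rs} => //= a s IHs.
by rewrite rev_cons foldr_rcons /= letter_invK eqxx.
Qed.

Lemma word_invK : involutive word_inv.
Proof.
move=> s; rewrite /word_inv map_rev revK -map_comp map_id_in // => a _.
exact: letter_invK.
Qed.

End FreeReduction.

Record free_group (T : choiceType) :=
  FreeGroup { free_word :> seq (T * bool); _ : reduced free_word }.

HB.instance Definition _ (T : choiceType) := [isSub for @free_word T].
HB.instance Definition _ (T : choiceType) := [Choice of free_group T by <:].

Section FreeGroup.
Variable T : choiceType.
Local Notation F := (free_group T).

Lemma free_wordP (u : F) : reduced u. Proof. exact: valP. Qed.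

Definition free_one : F := @FreeGroup T [::] isT.
Definition free_mul (u v : F) : F := FreeGroup (reduced_reduce (u ++ v)).
Definition free_inv (u : F) : F := FreeGroup (reduced_inv (free_wordP u)).

Lemma free_mulA : associative free_mul.
Proof.
move=> u v w; apply: val_inj => /=.
rewrite reduce_cat (reduce_id (reduced_reduce _)) [RHS]reduce_cat.
by rewrite foldr_reduce ?reduced_reduce // foldr_cat reduce_cat.
Qed.

Lemma free_mul1 : left_id free_one free_mul.
Proof. by move=> u; apply: val_inj; rewrite /= reduce_id ?free_wordP. Qed.

Lemma free_mulr1 : right_id free_one free_mul.
Proof. by move=> u; apply: val_inj; rewrite /= cats0 reduce_id ?free_wordP. Qed.

Lemma free_mulV : left_inverse free_one free_inv free_mul.
Proof. by move=> u; apply: val_inj; exact: reduce_mulV (free_wordP u). Qed.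

Lemma free_mulrV : right_inverse free_one free_inv free_mul.
Proof.
move=> u; apply: val_inj => /=; rewrite -{1}[free_word u]word_invK.
exact: reduce_mulV (reduced_inv (free_wordP u)).
Qed.

End FreeGroup.

HB.instance Definition _ (T : choiceType) :=
  isGroup.Build (free_group T) (@free_mulA T) (@free_mul1 T)
    (@free_mulr1 T) (@free_mulV T) (@free_mulrV T).

Definition free_gen (T : choiceType) (a : T) : free_group T :=
  @FreeGroup T [:: (a, false)] isT.

Section FreeEval.
Variables (T : choiceType) (G : groupType) (f : T -> G).

Definition free_eval (u : free_group T) : G :=
  \prod_(a <- free_word u) (if a.2 then (f a.1)^-1 else f a.1).

Lemma free_eval_gen a : free_eval (free_gen a) = f a.
Proof. by rewrite /free_eval big_seq1. Qed.

Lemma free_evalM (u v : free_group T) :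
  free_eval (u * v) = free_eval u * free_eval v.
Proof.
pose E (a : T * bool) := if a.2 then (f a.1)^-1 else f a.1.
have EV a : E (letter_inv a) = (E a)^-1.
  by case: a => a [] //=; rewrite /E /= invgK.
rewrite /free_eval -big_cat /=; elim: (free_word u ++ free_word v) => //= a s IHs.
rewrite big_cons -IHs; case: (reduce s) => [|b s'] /=; first by rewrite !big_cons.
case: eqP => [->|_]; last by rewrite !big_cons.
by rewrite big_cons -!/(E _) EV mulVKg.
Qed.

End FreeEval.

(* Free group on x and t, indexed by true and false respectively. *)
Notation F_xt := (free_group bool).
Definition gen_x : F_xt := free_gen true.
Definition gen_t : F_xt := free_gen false.

Definition subst_xt (G : groupType) (w : F_xt) (h z : G) : G :=
  free_eval (fun a : bool => if a then h else z) w.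

Definition N : set F_xt := normal_closure [set gen_x].
Definition N' : set F_xt := derived_subgroup N.

(* The data r, (m_i), (d_i) of a product (x^m_1)^(t^d_1) ... (x^m_r)^(t^d_r);
   indices run from 0 to r - 1. *)
Record expression := Expression {
  expr_len : nat;
  expr_m : 'I_expr_len -> int;
  expr_d : 'I_expr_len -> int
}.

Section Expressions.
Variable E : expression.
Local Notation r := (expr_len E).
Local Notation m := (@expr_m E).
Local Notation d := (@expr_d E).

Definition expr_value : F_xt :=
  \prod_(i < r) (zexpg gen_x (m i)) ^ (zexpg gen_t (d i)).

Definition expresses (w : F_xt) : Prop := (0 < r)%N /\ w = expr_value.

Definition tau (j : int) : {set 'I_r} := [set i | d i == j]%SET.

Definition S_w : pred int := fun j => (\sum_(i in tau j) m i != 0)%R.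

Definition S_w_sorted : seq int :=
  sort <=%O [seq j <- map d (enum 'I_r) | S_w j].

(* Junk value 0 when S_w is empty; see e_wP and d_wP. *)
Definition e_w : int := head 0%R S_w_sorted.
Definition d_w : int := last 0%R S_w_sorted.

Lemma mem_S_w_sorted j : (j \in S_w_sorted) = S_w j.
Proof.
rewrite mem_sort mem_filter andb_idr // => Sj.
have [i | tau0] := pickP (mem (tau j)).
  by rewrite /= inE => /eqP <-; apply: map_f; rewrite mem_enum.
by move: Sj; rewrite /S_w big_pred0 ?eqxx.
Qed.

Lemma e_wP : (exists j, S_w j) -> S_w e_w /\ forall j, S_w j -> (e_w <= j)%R.
Proof.
case=> j0; rewrite -mem_S_w_sorted => Sj0.
have := sort_sorted (@le_total _ int) [seq j <- map d (enum 'I_r) | S_w j].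
rewrite -/S_w_sorted /e_w; have := mem_S_w_sorted.
case: S_w_sorted Sj0 => //= a s _ memS pas; split=> [|j].
  by rewrite -memS mem_head.
rewrite -memS inE => /predU1P[-> //|js].
by have /allP/(_ _ js) := order_path_min le_trans pas.
Qed.

Lemma d_wP : (exists j, S_w j) -> S_w d_w /\ forall j, S_w j -> (j <= d_w)%R.
Proof.
case=> j0; rewrite -mem_S_w_sorted => Sj0.
have := sort_sorted (@le_total _ int) [seq j <- map d (enum 'I_r) | S_w j].
rewrite -/S_w_sorted /d_w; have := mem_S_w_sorted.
case/lastP: S_w_sorted Sj0 => // s a _ memS; rewrite last_rcons => pas.
split=> [|j]; first by rewrite -memS mem_rcons mem_head.
rewrite -memS mem_rcons inE => /predU1P[-> //|js].
move: pas; rewrite (sorted_pairwise le_trans) pairwise_rcons.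
by case/andP=> /allP/(_ _ js).
Qed.

(* Only indices i with d i >= e_w matter: the coefficients m i with d i = j
   add up to 0 for each j < e_w, so the absolute value in the exponent does not
   change the polynomial. *)
Definition A_w : {poly int} := (\sum_(i < r) m i *: 'X^(`|d i - e_w|%N))%R.

End Expressions.

Definition tidy (E : expression) : Prop :=
  [/\ (N `\` N') (expr_value E),
      forall j, (d_w E < j)%R -> tau E j = finset.set0 &
      forall j, (j < e_w E)%R -> tau E j = finset.set0].

(* Main.v *)
(* Conjugating by a power of z, w(h,z) = 1 becomes a relation between the
   conjugates y_k = h^(z^k), 0 <= k <= deg A_w.  If h and y_1 lie in different
   archimedean classes, then one of y_0 and y_(deg A_w) is infinitely larger
   than all the other conjugates involved, so that its total exponent, the
   constant or the leading coefficient of A_w, would have to vanish.  Otherwise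
   conjugation by z preserves the convex subgroup spanned by h, on which there
   is, up to scaling, a unique monotone homomorphism s to the reals (Hoelder);
   hence s (g^z) = a * s g for some a > 0, and applying s to the relation shows
   that a is a root of A_w. *)
Require Import Defs.
From HB Require Import structures.
From mathcomp Require Import all_boot all_order all_algebra.
From mathcomp Require Import boolp classical_sets reals.

Set Implicit Arguments.
Unset Strict Implicit.
Unset Printing Implicit Defensive.

Import Order.TTheory GRing.Theory Num.Theory.
Local Open Scope ring_scope.

(** * Integer powers of group elements *)

Section IntegerPowers.
Local Open Scope group_scope.
Variable G : groupType.
Implicit Types (g x : G) (p q : int).

Lemma zexpgBn g a b : zexpg g (a%:Z - b%:Z)%R = g ^+ a * g ^- b.
Proof.
have [ba|ab] := leqP b a; first by rewrite subzn //= expgnFr.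
have -> : (a%:Z - b%:Z = - (b - a)%:Z)%R by rewrite -subzn 1?ltnW // opprB.
have : (0 < b - a)%N by rewrite subn_gt0.
case bae: (b - a)%N => [//|k] _; rewrite -NegzE /= -bae expgnFr 1?ltnW //.
by rewrite invgF.
Qed.

Lemma zexpgD g p q : zexpg g (p + q)%R = zexpg g p * zexpg g q.
Proof.
(* Writing integers as differences of naturals avoids a case analysis on signs. *)
have intB r : exists a b : nat, r = (a%:Z - b%:Z)%R.
  case: r => n; first by exists n, 0; rewrite subr0.
  by exists 0, n.+1; rewrite sub0r NegzE.
have [a [b ->]] := intB p; have [a' [b' ->]] := intB q.
have -> : (a%:Z - b%:Z + (a'%:Z - b'%:Z) = (a + a')%N%:Z - (b' + b)%N%:Z)%R.
  by rewrite !PoszD opprD addrACA [X in (_ + X)%R]addrC.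
rewrite !zexpgBn !expgnDr invgM.
have cXV m n : commute (g ^+ m) (g ^- n) by apply/commuteV/commuteX2.
by rewrite -!mulgA; congr (_ * _); rewrite !mulgA; congr (_ * _); apply: cXV.
Qed.

Lemma zexpgN g p : zexpg g (- p)%R = (zexpg g p)^-1.
Proof. by apply/esym/mulg1_eq; rewrite -zexpgD subrr. Qed.

Lemma zexpgMn g p n : zexpg g (p * n%:Z)%R = zexpg g p ^+ n.
Proof.
elim: n => [|n IHn]; first by rewrite mulr0.
by rewrite intS mulrDr mulr1 zexpgD IHn expgS.
Qed.

Lemma zexpg_conj g x p : zexpg g p ^ x = zexpg (g ^ x) p.
Proof. by case: p => n /=; rewrite ?conjVg conjXg. Qed.

Lemma zexpVg g p : zexpg g^-1 p = (zexpg g p)^-1.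
Proof. by case: p => n /=; rewrite expVgn. Qed.

End IntegerPowers.

(** * Inequalities in bi-ordered groups, and the convex subgroup of an element *)

Section BiOrderedGroups.
Local Open Scope group_scope.
Local Open Scope order_scope.
Variables (disp : Order.disp_t) (G : biOrderedGroupType disp).
Implicit Types (c g u v x y : G) (p q : int).

Lemma leg_mul2r x u v : u <= v -> u * x <= v * x.
Proof. by rewrite le_eqVlt => /predU1P[-> //|/(ltg_mul2r x)/ltW]. Qed.

Lemma leg_mul2l x u v : u <= v -> x * u <= x * v.
Proof. by rewrite le_eqVlt => /predU1P[-> //|/(ltg_mul2l x)/ltW]. Qed.

Lemma leg_mul u u' v v' : u <= v -> u' <= v' -> u * u' <= v * v'.
Proof. by move=> uv uv'; apply/(le_trans (leg_mul2r _ uv))/leg_mul2l. Qed.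

Lemma leg_expn u v n : u <= v -> u ^+ n <= v ^+ n.
Proof. by move=> uv; elim: n => // n IHn; rewrite !expgS leg_mul. Qed.

Lemma leg_conj x u v : u <= v -> u ^ x <= v ^ x.
Proof. by move=> uv; rewrite !conjgE leg_mul2l ?leg_mul2r. Qed.

Lemma ltg_conj x u v : u < v -> u ^ x < v ^ x.
Proof. by move=> uv; rewrite !conjgE ltg_mul2l ?ltg_mul2r. Qed.

Lemma leg_inv u v : u <= v -> v^-1 <= u^-1.
Proof.
by move/(leg_mul2l u^-1)/(leg_mul2r v^-1); rewrite mulVg mul1g mulgK.
Qed.

Lemma ltg_inv u v : u < v -> v^-1 < u^-1.
Proof.
by move/(ltg_mul2l u^-1)/(ltg_mul2r v^-1); rewrite mulVg mul1g mulgK.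
Qed.

Lemma expg_ge1 c n : 1 <= c -> 1 <= c ^+ n.
Proof. by move/(@leg_expn _ _ n); rewrite expg1n. Qed.

Lemma expg_gt1 c n : 1 < c -> 1 < c ^+ n.+1.
Proof.
move=> c1; apply: (lt_le_trans c1); rewrite expgS -{1}[c]mulg1.
by apply/leg_mul2l/expg_ge1/ltW.
Qed.

Lemma leg_exp2l c m n : 1 <= c -> (m <= n)%N -> c ^+ m <= c ^+ n.
Proof.
move=> c1 mn; rewrite -(subnK mn) expgnDr -{1}[c ^+ m]mul1g.
exact/leg_mul2r/expg_ge1.
Qed.

Lemma ltg_zexp2l c p q : 1 < c -> (p < q)%R -> zexpg c p < zexpg c q.
Proof.
move=> c1; rewrite -subr_gt0; case qp: (q - p)%R => [[//|n]|//] _.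
have -> : q = (p + n.+1%:Z)%R by rewrite -qp addrC subrK.
by rewrite zexpgD -{1}[zexpg c p]mulg1 ltg_mul2l ?expg_gt1.
Qed.

Lemma zexpg_le2l c p q : 1 < c -> zexpg c p <= zexpg c q -> (p <= q)%R.
Proof. by move=> c1; apply: contraTle => /(ltg_zexp2l c1); rewrite -ltNge. Qed.

(** Replacing an adjacent [u v] by [v u] can only increase a product, and [u ^+ n * v ^+ n] has
    every [u] to the left of every [v]. *)
Lemma expgM_le_of_commute_le u v n : u * v <= v * u ->
  u ^+ n * v ^+ n <= (u * v) ^+ n.
Proof.
move=> uv; have uvn k : u ^+ k * v <= v * u ^+ k.
  elim: k => [|k IHk]; first by rewrite mulg1 mul1g.
  rewrite expgS -mulgA (le_trans (leg_mul2l u IHk)) // !mulgA.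
  exact: leg_mul2r.
elim: n => [|n IHn]; first by rewrite mulg1.
rewrite expgSr [v ^+ _]expgS [(u * v) ^+ _]expgS.
apply: le_trans (leg_mul2l (u * v) IHn).
rewrite -expgSr expgS -!mulgA; apply: leg_mul2l; rewrite !mulgA.
exact/leg_mul2r/uvn.
Qed.

(** Mirror case: now it is moving a [v] to the right past a [u] that increases products. *)
Lemma expgM_le_of_commute_ge u v n : v * u <= u * v ->
  v ^+ n * u ^+ n <= (u * v) ^+ n.
Proof.
move=> vu; have uvn k : v * u ^+ k <= u ^+ k * v.
  elim: k => [|k IHk]; first by rewrite mulg1 mul1g.
  rewrite [u ^+ k.+1]expgS mulgA (le_trans (leg_mul2r _ vu)) // -!mulgA.
  exact: leg_mul2l.
elim: n => [|n IHn]; first by rewrite mulg1.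
rewrite expgSr [u ^+ _]expgS [(u * v) ^+ _]expgSr -mulgA.
apply: le_trans (leg_mul2r (u * v) IHn).
rewrite -!mulgA; apply: leg_mul2l; rewrite -expgS expgSr !mulgA.
rewrite -[X in _ <= X]mulgA (le_trans _ (leg_mul2l _ vu)) // !mulgA.
exact/leg_mul2r/uvn.
Qed.

(* The two products of u^n and v^n bound (u v)^n from below in one order or the
   other, and c^p, c^q commute: this makes archimedean_size additive without
   any commutation between u and v. *)
Lemma zexpgM_le c u v p q n : zexpg c p <= u ^+ n -> zexpg c q <= v ^+ n ->
  zexpg c (p + q)%R <= (u * v) ^+ n.
Proof.
move=> cu cv; have [uv|/ltW vu] := leP (u * v) (v * u).
  rewrite zexpgD; apply: le_trans (expgM_le_of_commute_le n uv).
  exact: leg_mul.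
rewrite addrC zexpgD; apply: le_trans (expgM_le_of_commute_ge n vu).
exact: leg_mul.
Qed.

(** For [1 < c] this is membership in the convex subgroup generated by [c]. *)
Definition bounded_by c g := exists n, c ^- n <= g /\ g <= c ^+ n.

Section Bounded.
Variable c : G.
Hypothesis c1 : 1 < c.

Let expg_mono m n : (m <= n)%N -> c ^+ m <= c ^+ n.
Proof. exact/leg_exp2l/ltW. Qed.

Lemma bounded_ge1 g n : 1 <= g -> g <= c ^+ n -> bounded_by c g.
Proof.
move=> g1 gn; exists n; split=> //; apply: le_trans g1.
by rewrite -invg1; apply/leg_inv/expg_ge1/ltW.
Qed.

Lemma bounded_1 : bounded_by c 1.
Proof. exact: (@bounded_ge1 _ 0). Qed.

Lemma bounded_refl : bounded_by c c.
Proof. exact: (@bounded_ge1 _ 1 (ltW c1)). Qed.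

Lemma boundedV g : bounded_by c g -> bounded_by c g^-1.
Proof.
case=> n [cg gc]; exists n; split; first exact: leg_inv.
by rewrite -[c ^+ n]invgK; apply: leg_inv.
Qed.

Lemma boundedM u v : bounded_by c u -> bounded_by c v -> bounded_by c (u * v).
Proof.
case=> m [cu uc] [n [cv vc]]; exists (m + n)%N; split.
  by rewrite addnC expgnDr invgM leg_mul.
by rewrite expgnDr leg_mul.
Qed.

Lemma boundedX g n : bounded_by c g -> bounded_by c (g ^+ n).
Proof.
move=> gB; elim: n => [|n IHn]; first exact: bounded_1.
by rewrite expgS; apply: boundedM.
Qed.

Lemma bounded_zexp g p : bounded_by c g -> bounded_by c (zexpg g p).
Proof. by move=> gB; case: p => n /=; [|apply: boundedV]; exact: boundedX. Qed.

End Bounded.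

End BiOrderedGroups.

(** * Hoelder's theorem: monotone homomorphisms to the reals *)

Section MonotoneHom.
Local Open Scope group_scope.
Local Open Scope order_scope.
Variables (R : realType) (disp : Order.disp_t) (G : biOrderedGroupType disp).
Variable c : G.
Hypothesis c1 : 1 < c.
Implicit Types (g u v : G) (p : int) (psi : G -> R).

(** A homomorphism on the convex subgroup of [c] only, represented by a total function whose values
    elsewhere are arbitrary. *)
Definition monotone_hom psi :=
  (forall u v, bounded_by c u -> bounded_by c v ->
     psi (u * v) = (psi u + psi v)%R) /\
  (forall u v, bounded_by c u -> bounded_by c v -> u <= v ->
     (psi u <= psi v)%R).

Section Hom.
Variable psi : G -> R.
Hypothesis psi_hom : monotone_hom psi.

Lemma monotone_hom1 : psi 1 = 0%R.
Proof.
have [psiM _] := psi_hom; have B1 := bounded_1 c1.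
by apply: (addrI (psi 1)); rewrite addr0 -psiM // mulg1.
Qed.

Lemma monotone_homV g : bounded_by c g -> psi g^-1 = (- psi g)%R.
Proof.
have [psiM _] := psi_hom; move=> Bg; apply: (addrI (psi g)).
by rewrite subrr -psiM ?mulgV ?monotone_hom1 //; exact: boundedV.
Qed.

Lemma monotone_homX g n : bounded_by c g -> psi (g ^+ n) = (psi g *+ n)%R.
Proof.
have [psiM _] := psi_hom; move=> Bg; elim: n => [|n IHn].
  exact: monotone_hom1.
by rewrite expgS psiM ?IHn ?mulrS //; exact: boundedX.
Qed.

Lemma monotone_homZ g p :
  bounded_by c g -> psi (zexpg g p) = (p%:~R * psi g)%R.
Proof.
move=> Bg; rewrite mulrC mulrzr; case: p => n /=; first exact: monotone_homX.
by rewrite monotone_homV ?monotone_homX //; exact: boundedX.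
Qed.

Lemma monotone_hom_prod r (m : 'I_r -> int) (F : 'I_r -> G) :
    (forall i, bounded_by c (F i)) ->
  psi (\prod_(i < r) zexpg (F i) (m i)) =
  (\sum_(i < r) (m i)%:~R * psi (F i))%R.
Proof.
move=> FB; have [psiM _] := psi_hom.
(* Boundedness is carried through the induction, since additivity holds only between bounded
   elements. *)
suff [] : bounded_by c (\prod_(i < r) zexpg (F i) (m i)) /\
  psi (\prod_(i < r) zexpg (F i) (m i)) =
  (\sum_(i < r) (m i)%:~R * psi (F i))%R.
  by [].
apply: (big_rec2 (fun u a => bounded_by c u /\ psi u = a)).
  by split; [exact: bounded_1 | exact: monotone_hom1].
move=> i u a _ [Bu <-]; have Bi := bounded_zexp c1 (m i) (FB i).
by split; [exact: boundedM | rewrite psiM ?monotone_homZ].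
Qed.

Lemma monotone_hom_ge0 g : bounded_by c g -> 1 <= g -> (0 <= psi g)%R.
Proof.
have [_ psi_le] := psi_hom; move=> Bg /(psi_le _ _ (bounded_1 c1) Bg).
by rewrite monotone_hom1.
Qed.

(** All multiples of [psi g] stay below [psi c], so the archimedean property of the reals forces it
    to vanish. *)
Lemma monotone_hom_infinitesimal g :
  1 <= g -> (forall n, g ^+ n <= c) -> psi g = 0%R.
Proof.
have [_ psi_le] := psi_hom; move=> g1 gc.
have Bg : bounded_by c g by apply: (bounded_ge1 (n := 1%N) c1 g1 (gc 1%N)).
apply/le_anti; rewrite monotone_hom_ge0 // andbT leNgt; apply/negP => psig0.
have Bc := bounded_refl c1; have psic := monotone_hom_ge0 Bc (ltW c1).
have := archi_boundP (divr_ge0 psic (ltW psig0)).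
rewrite ltr_pdivrMr // mulr_natl -monotone_homX // ltNge.
by rewrite psi_le //; exact: boundedX.
Qed.

End Hom.

(** The lower cut of the real number measuring [g] in units of [c]; the denominator [n.+1] keeps it
    positive. *)
Definition archimedean_ratios g : set R :=
  [set x | exists p n,
     x = (p%:~R / n.+1%:R)%R /\ zexpg c p <= g ^+ n.+1]%classic.

Definition archimedean_size g : R := sup (archimedean_ratios g).

Local Notation size_c := archimedean_size.

Lemma archimedean_size_ge g p n : bounded_by c g ->
  zexpg c p <= g ^+ n.+1 -> (p%:~R / n.+1%:R <= size_c g)%R.
Proof.
case=> k [_ gk] cg; apply: ub_le_sup; last by exists p, n.
(* A supremum needs an upper bound: [g <= c ^+ k] bounds every ratio by [k]. *)
exists k%:R => _ [q [l [-> cq]]]; rewrite ler_pdivrMr ?ltr0Sn // -natrM.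
rewrite -[X in (_ <= X)%R]/((k * l.+1)%:Z%:~R)%R ler_int.
apply: (zexpg_le2l c1); apply: (le_trans cq).
by rewrite /= expgnA; apply: leg_expn.
Qed.

Lemma archimedean_size_le g x : bounded_by c g ->
    (forall p n, zexpg c p <= g ^+ n.+1 -> (p%:~R / n.+1%:R <= x)%R) ->
  (size_c g <= x)%R.
Proof.
move=> [k [kg _]] xub; apply: ge_sup; last by move=> _ [p [n [-> /xub]]].
(* The set is nonempty: [c ^- k <= g] provides the ratio [-k / 1]. *)
by exists ((- k%:Z)%:~R / 1%:R)%R, (- k%:Z)%R, 0%N; rewrite zexpgN.
Qed.

Lemma archimedean_size_refl : size_c c = 1%R.
Proof.
have Bc := bounded_refl c1; apply/le_anti/andP; split.
  apply: archimedean_size_le => // p n cp.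
  rewrite ler_pdivrMr ?ltr0Sn // mul1r.
  by rewrite -[X in (_ <= X)%R]/(n.+1%:Z%:~R)%R ler_int (zexpg_le2l c1).
by rewrite -[X in (X <= _)%R](divr1 1%R) (@archimedean_size_ge _ 1 0).
Qed.

Lemma archimedean_size_mono u v : bounded_by c u -> bounded_by c v ->
  u <= v -> (size_c u <= size_c v)%R.
Proof.
move=> Bu Bv uv; apply: archimedean_size_le => // p n cp.
by apply: archimedean_size_ge => //; apply/(le_trans cp)/leg_expn.
Qed.

(** Two ratios are brought to a common denominator, where [zexpgM_le] adds their numerators. *)
Lemma archimedean_size_superadd u v : bounded_by c u -> bounded_by c v ->
  (size_c u + size_c v <= size_c (u * v)%g)%R.
Proof.
move=> Bu Bv; rewrite -lerBrDr; apply: archimedean_size_le => // p n cp.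
rewrite lerBrDr addrC -lerBrDr; apply: archimedean_size_le => // q k cq.
rewrite lerBrDr addrC addf_div ?pnatr_eq0 // -natrM mulnSr addnS.
rewrite -[k.+1%:R]/(k.+1%:Z%:~R)%R -[n.+1%:R]/(n.+1%:Z%:~R)%R -!intrM -intrD.
apply: archimedean_size_ge; first exact: boundedM.
rewrite -addnS -mulnSr; apply: zexpgM_le; rewrite zexpgMn.
  by rewrite expgnA; apply: leg_expn.
by rewrite mulnC expgnA; apply: leg_expn.
Qed.

(** Counting up from the lower bound [c ^- k] turns the search for the largest [p] into one over
    naturals at most [k + k]. *)
Lemma exists_floor g n : bounded_by c g ->
  exists p, zexpg c p <= g ^+ n /\ g ^+ n <= zexpg c (p + 1)%R.
Proof.
move=> /(boundedX c1 n); move: (g ^+ n) => {}g [k [kg gk]].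
have cN m : c ^- k * c ^+ m = zexpg c (m%:Z - k%:Z)%R.
  by rewrite addrC zexpgD zexpgN.
pose P m := c ^- k * c ^+ m <= g.
have P0 : exists m, P m by exists 0%N; rewrite /P mulg1.
have Pub m : P m -> (m <= k + k)%N.
  rewrite /P cN => /le_trans/(_ gk) ck; have := @zexpg_le2l _ _ _ _ k%:Z c1 ck.
  by rewrite lerBlDr -PoszD.
have [m Pm m_max] := ex_maxnP P0 Pub.
exists (m%:Z - k%:Z)%R; rewrite -cN; split=> //.
rewrite addrAC -PoszD addn1 -cN; apply/ltW; rewrite ltNge.
by apply/negP => /m_max; rewrite ltnn.
Qed.

(** Superadditivity bounds the sum of the two sizes by the size of 1, which is at most 0.
    Conversely, a floor [p] of [g ^+ n.+1] gives the ratio [p / n.+1] for [g] and [-(p + 1) / n.+1]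
    for [g^-1], so the sum is at least [-1 / n.+1] for suitably large [n]. *)
Lemma archimedean_sizeV g : bounded_by c g -> size_c g^-1 = (- size_c g)%R.
Proof.
move=> Bg; have BV := boundedV Bg; apply/eqP; rewrite -addr_eq0 addrC.
rewrite eq_le; apply/andP; split.
  apply: le_trans (archimedean_size_superadd Bg BV) _.
  rewrite mulgV; apply: archimedean_size_le => [|p n]; first exact: bounded_1.
  rewrite expg1n => p0; rewrite ler_pdivrMr ?ltr0Sn // mul0r lerz0.
  exact: (@zexpg_le2l _ _ _ p 0 c1 p0).
rewrite -oppr_le0 leNgt; apply/negP.
set e := (- (size_c g + _))%R => e0.
have e0' : (0 < e^-1)%R by rewrite invr_gt0.
have := archi_boundP (ltW e0'); case: (Num.bound _) => [|n].
  by rewrite ltNge ltW.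
rewrite -[X in (X < _)%R]div1r ltr_pdivrMr // mulrC -ltr_pdivrMr ?ltr0Sn //.
rewrite div1r ltNge => /negP; apply.
have [p [cp pc]] := exists_floor n.+1 Bg.
have pV : zexpg c (- (p + 1))%R <= g^-1 ^+ n.+1.
  by rewrite zexpgN expVgn leg_inv.
have := lerD (archimedean_size_ge Bg cp) (archimedean_size_ge BV pV).
by rewrite -mulrDl -intrD opprD addNKr mulN1r lerNl.
Qed.

Lemma archimedean_size_hom : monotone_hom archimedean_size.
Proof.
split=> [u v Bu Bv|u v]; last exact: archimedean_size_mono.
apply/le_anti; rewrite archimedean_size_superadd // andbT.
(* Subadditivity is superadditivity for the factors [u * v] and [v^-1] of [u]. *)
have := archimedean_size_superadd (boundedM Bu Bv) (boundedV Bv).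
by rewrite mulgK archimedean_sizeV // lerBlDr.
Qed.

(* The inequality obtained from the supremum for g^-1 is the opposite one for
   g. *)
Lemma monotone_homE psi g : monotone_hom psi -> bounded_by c g ->
  psi g = (psi c * archimedean_size g)%R.
Proof.
move=> psi_hom; have [_ psi_le] := psi_hom.
have Bc := bounded_refl c1; have psic := monotone_hom_ge0 psi_hom Bc (ltW c1).
have le u : bounded_by c u -> (psi c * archimedean_size u <= psi u)%R.
  move=> Bu; have ratio p n : zexpg c p <= u ^+ n.+1 ->
      (psi c * (p%:~R / n.+1%:R) <= psi u)%R.
    move=> cp; rewrite mulrA ler_pdivrMr ?ltr0Sn // mulrC -monotone_homZ //.
    rewrite mulr_natr -monotone_homX // psi_le //; last exact: boundedX.
    exact: bounded_zexp.
  (* Division by [psi c] fails when it is 0; then any single ratio, here [-k], gives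
     [0 <= psi u]. *)
  have [psi0|psi0] := eqVneq (psi c) 0%R.
    have [k [ku _]] := Bu; have := @ratio (- k%:Z)%R 0%N.
    by rewrite zexpgN psi0 !mul0r; apply.
  have psic0 : (0 < psi c)%R by rewrite lt_def psi0.
  rewrite mulrC -ler_pdivlMr //; apply: archimedean_size_le => // p n /ratio.
  by rewrite ler_pdivlMr // mulrC.
move=> Bg; apply/le_anti; rewrite le // andbT.
have := le _ (boundedV Bg); rewrite archimedean_sizeV //.
by rewrite (monotone_homV psi_hom) // mulrN lerN2.
Qed.

End MonotoneHom.

(** * Relations between conjugates of [h] by powers of [z] *)

Section ConjugationRoot.
Local Open Scope group_scope.
Local Open Scope order_scope.
Variables (R : realType) (disp : Order.disp_t) (G : biOrderedGroupType disp).
Implicit Types (c h z : G).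

(** Under the size relative to [c], factors in [P] count 1 and the others, being infinitesimal,
    count 0; the size of the product is thus the total exponent of [c]. *)
Lemma dominated_prod_eq1 c r (m : 'I_r -> int) (F : 'I_r -> G)
    (P : pred 'I_r) : 1 < c ->
    (forall i, P i -> F i = c) ->
    (forall i, ~~ P i -> 1 <= F i /\ forall n, F i ^+ n <= c) ->
  \prod_(i < r) zexpg (F i) (m i) = 1 -> \sum_(i | P i) m i = 0%R.
Proof.
move=> c1 FP FNP prod1; have size_hom := archimedean_size_hom R c1.
have FB i : bounded_by c (F i).
  have [/FP ->|/FNP[F1 Fc]] := boolP (P i); first exact: bounded_refl.
  exact: (bounded_ge1 (n := 1%N) c1 F1 (Fc 1%N)).
have := monotone_hom_prod c1 size_hom m FB.
rewrite prod1 (monotone_hom1 c1 size_hom) (bigID P) /=.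
rewrite [X in (_ + X)%R]big1 => [|i /FNP[F1 Fc]]; last first.
  by rewrite (monotone_hom_infinitesimal c1 size_hom) ?mulr0.
rewrite addr0 (eq_bigr (fun i => (m i)%:~R)%R) => [|i /FP ->]; last first.
  by rewrite archimedean_size_refl ?mulr1.
by rewrite -mulrz_sumr => /esym/eqP; rewrite intr_eq0 => /eqP.
Qed.

(** The two nonzero sums are the constant and the leading coefficient; each excludes one of the two
    ways in which [h] and [h ^ z] can fail to be archimedean equivalent. *)
Lemma conjugation_root h z r (m : 'I_r -> int) (k : 'I_r -> nat) D : 1 < h ->
    (forall i, (k i <= D)%N) ->
    \sum_(i | k i == 0%N) m i != 0%R -> \sum_(i | k i == D) m i != 0%R ->
    \prod_(i < r) zexpg (h ^ (z ^+ k i)) (m i) = 1 ->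
  exists2 a : R, (0 < a)%R & (\sum_(i < r) (m i)%:~R * a ^+ k i = 0)%R.
Proof.
move=> h1 kD sum0 sumD prod1; pose y l := h ^ (z ^+ l).
have y0 : y 0%N = h by rewrite /y expg0 conjg1.
have yS l : y l.+1 = y l ^ z by rewrite /y expgSr conjgM.
have hz : h ^ z = y 1%N by rewrite yS y0.
have y1 l : 1 < y l by rewrite -[1](conj1g (z ^+ l)); apply: ltg_conj.
(* If [y 1] exceeds all powers of [h], conjugating by powers of [z] shows that each [y l.+1]
   dominates all powers of [y l]; then [y D] dominates, contradicting [sumD]. *)
have [[n0 yn]|ybig] := pselect (exists n, y 1%N <= h ^+ n); last first.
  have yX l n : y l ^+ n <= y l.+1.
    elim: l => [|l IHl]; last by rewrite !yS -conjXg leg_conj // -yS.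
    by rewrite y0 ltW // ltNge; apply/negP => yn; apply: ybig; exists n.
  have ylt l l' n : (l < l')%N -> y l ^+ n <= y l'.
    elim: l' => // l' IHl'; rewrite ltnS leq_eqVlt.
    move=> /predU1P[->|/IHl' le1]; first exact: yX.
    exact: le_trans le1 (yX _ 1%N).
  case/negP: sumD; apply/eqP.
  apply: (dominated_prod_eq1 (F := y \o k) (y1 D)) prod1
    => [i /= /eqP -> //|i ki].
  by split=> [|n] /=; [exact: ltW | rewrite ylt // ltn_neqAle ki kD].
(* If [h] exceeds all powers of [y 1], the domination is reversed: [y 0] dominates, contradicting
   [sum0]. *)
have [[n1 hn]|ysmall] := pselect (exists n, h <= y 1%N ^+ n); last first.
  have yX l n : y l.+1 ^+ n <= y l.
    elim: l => [|l IHl]; last first.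
      by rewrite [y l.+2]yS -conjXg [X in _ <= X]yS leg_conj.
    by rewrite y0 ltW // ltNge; apply/negP => hn; apply: ysmall; exists n.
  have ylt l n : y l.+1 ^+ n <= y 0%N.
    elim: l n => // l IHl n; apply: le_trans (yX _ n) (IHl 1%N).
  case/negP: sum0; apply/eqP.
  apply: (dominated_prod_eq1 (F := y \o k) (y1 0%N)) prod1
    => [i /= /eqP -> //|i ki].
  split=> [|l] /=; first exact: ltW.
  by case: (k i) ki => // l' _; apply: ylt.
have size_hom := archimedean_size_hom R h1.
set s := archimedean_size _ _ in size_hom.
have By1 : bounded_by h (y 1%N) by apply: bounded_ge1 yn => //; exact: ltW.
(* As [h ^ z <= h ^+ n0], conjugation by [z] preserves the convex subgroup of [h]. *)
have BJ g : bounded_by h g -> bounded_by h (g ^ z).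
  move=> [l [gl lg]]; exists (n0 * l)%N; split.
    apply: le_trans (leg_conj z gl); rewrite conjVg conjXg hz expgnA.
    exact/leg_inv/leg_expn.
  apply: le_trans (leg_conj z lg) _; rewrite conjXg hz expgnA.
  exact/leg_expn.
have By l : bounded_by h (y l).
  elim: l => [|l IHl]; first by rewrite y0; exact: bounded_refl.
  by rewrite yS; exact: BJ.
(* Conjugation followed by [s] is again a monotone homomorphism, hence a multiple of [s], with
   factor its value at [h]. *)
have sJ g : bounded_by h g -> s (g ^ z) = (s (y 1%N) * s g)%R.
  rewrite -hz => Bg.
  apply: (monotone_homE h1 (psi := fun g => s (g ^ z))) => //.
  have [sM s_le] := size_hom.
  split=> [u v Bu Bv|u v Bu Bv uv]; first by rewrite conjMg sM //; exact: BJ.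
  by apply: s_le; [exact: BJ.. | exact: leg_conj].
have sy l : s (y l) = (s (y 1%N) ^+ l)%R.
  elim: l => [|l IHl]; first by rewrite y0 expr0 /s archimedean_size_refl.
  by rewrite yS sJ // IHl exprS.
exists (s (y 1%N)).
  rewrite lt_def (monotone_hom_ge0 h1 size_hom) ?ltW // andbT.
  have [_ s_le] := size_hom.
  (* Were the factor 0, applying [s] to [h <= y 1 ^+ n1] would give [1 <= 0]. *)
  apply/eqP => sy0; have := s_le _ _ (bounded_refl h1) (boundedX h1 n1 By1) hn.
  rewrite (monotone_homX h1 size_hom) // sy0 mul0rn /s archimedean_size_refl //.
  by rewrite ler10.
have := monotone_hom_prod h1 size_hom m (fun i => By (k i)).
rewrite prod1 (monotone_hom1 h1 size_hom) => sum_y; rewrite [RHS]sum_y.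
by apply: eq_bigr => i _; rewrite -sy.
Qed.

End ConjugationRoot.

(** * Products of powers lying in a derived subgroup *)

Section DerivedSubgroup.
Local Open Scope group_scope.
Variable G : groupType.
Implicit Types (A H K : set G) (g u v : G).

Lemma subgroupM K u v : is_subgroup K -> K u -> K v -> K (u * v).
Proof.
case=> K1 KF Ku Kv; rewrite -[v]invgK; apply: (KF) => //.
by rewrite -[v^-1]mul1g; apply: KF.
Qed.

Lemma subgroupV K u : is_subgroup K -> K u -> K u^-1.
Proof. by case=> K1 KF Ku; rewrite -[u^-1]mul1g; apply: KF. Qed.

Lemma subgroup_prod K I (s : seq I) (F : I -> G) :
  is_subgroup K -> (forall i, K (F i)) -> K (\prod_(i <- s) F i).
Proof.
move=> Ksub KF; apply: big_ind => //; first by case: Ksub.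
by move=> u v; exact: subgroupM.
Qed.

Lemma subgroup_zexpg K u p : is_subgroup K -> K u -> K (zexpg u p).
Proof.
move=> Ksub Ku; have KX n : K (u ^+ n).
  elim: n => [|n IHn]; first by case: Ksub.
  by rewrite expgS; apply: subgroupM.
by case: p => n /=; [|apply: subgroupV].
Qed.

Lemma normal_closure_normal A : is_normal_subgroup (normal_closure A).
Proof.
split; first split.
- by move=> K [[[K1 _] _] _].
- move=> u v Nu Nv K KA; case: (KA) => -[[_ KF] _] _.
  by apply: KF; [exact: Nu | exact: Nv].
- by move=> u v Nu K KA; case: (KA) => -[_ KJ] _; apply: KJ; exact: Nu.
Qed.

Lemma sub_normal_closure A : (A `<=` normal_closure A)%classic.
Proof. by move=> u Au K [_]; apply. Qed.

Lemma derived_subgroup_subgroup H : is_subgroup (derived_subgroup H).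
Proof.
split; first by move=> K [[]].
move=> u v Hu Hv K KH; case: (KH) => -[_ KF] _.
by apply: KF; [exact: Hu | exact: Hv].
Qed.

Lemma mem_commg_derived H u v : H u -> H v -> derived_subgroup H [~ u, v].
Proof. by move=> Hu Hv K [_]; apply; exists u, v. Qed.

(** The two products differ by the left factor [[~ u^-1, v^-1]]. *)
Lemma derived_mulC H u v g : is_subgroup H -> H u -> H v ->
  derived_subgroup H (v * u * g) -> derived_subgroup H (u * v * g).
Proof.
move=> Hsub Hu Hv Dg; rewrite [u * v]commgCV -mulgA.
apply: (subgroupM (derived_subgroup_subgroup H)) => //.
by apply: mem_commg_derived; exact: subgroupV.
Qed.

(* The factors with equal base are gathered one by one, each move costing a
   commutator of elements of H. *)
Lemma prod_zexpg_derived (I : eqType) H (y : I -> G) (s : seq (int * I)) :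
    is_subgroup H -> (forall j, H (y j)) ->
    (forall j, \sum_(a <- s | a.2 == j) a.1 = 0)%R ->
  derived_subgroup H (\prod_(a <- s) zexpg (y a.2) a.1).
Proof.
move=> Hsub Hy; have Dsub := derived_subgroup_subgroup H.
have HP t : H (\prod_(a <- t) zexpg (y a.2) a.1).
  by apply: subgroup_prod => // a; apply: subgroup_zexpg.
have [n] := ubnP (size s); elim: n s => // n IHn [|[p j] s] sn sum0.
  by rewrite big_nil; case: Dsub.
(* If the base [j] does not recur in [s], its exponent sum is [p] alone, so [p] is 0. *)
have [js|js] := boolP (has (fun a => a.2 == j) s); last first.
  have := sum0 j; rewrite big_cons eqxx big_hasC // addr0 /= => p0.
  rewrite big_cons p0 mul1g; apply: IHn => // i.
  rewrite -[RHS](sum0 i) big_cons.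
  by case: ifP; rewrite //= p0 add0r.
move: sn sum0.
case/split_find: js => -[q j'] s1 s2 /= /eqP -> _ sn sum0.
(* Merging the head into the next factor with base [j] shortens the list and keeps all exponent
   sums. *)
have : derived_subgroup H
    (\prod_(a <- s1 ++ (p + q, j)%R :: s2) zexpg (y a.2) a.1).
  apply: IHn => [|i].
    by move: sn; rewrite !size_cat size_rcons /= addSnnS.
  rewrite -[RHS](sum0 i) !(big_cons, big_cat, big_rcons) /=.
  by case: ifP => _; rewrite ?addr0 // -!addrA addrCA.
rewrite big_cons !big_cat big_rcons big_cons /= zexpgD !mulgA => D.
rewrite -!mulgA mulgA; apply: derived_mulC => //; last by rewrite !mulgA.
exact: subgroup_zexpg.
Qed.

End DerivedSubgroup.

(** * Values of expressions under substitution and modulo [N'] *)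

Section Expressions.
Local Open Scope group_scope.

Lemma subst_expr_value (G : groupType) (E : expression) (h z : G) :
  subst_xt (expr_value E) h z =
  \prod_(i < expr_len E) zexpg h (expr_m i) ^ zexpg z (expr_d i).
Proof.
pose f (a : bool) := if a then h else z.
have f1 : free_eval f 1 = 1 by rewrite /free_eval big_nil.
have fV u : free_eval f u^-1 = (free_eval f u)^-1.
  by apply/esym/mulg1_eq; rewrite -free_evalM mulgV f1.
have fX u n : free_eval f (u ^+ n) = free_eval f u ^+ n.
  elim: n => [|n IHn]; first exact: f1.
  by rewrite !expgS free_evalM IHn.
have fZ u p : free_eval f (zexpg u p) = zexpg (free_eval f u) p.
  by case: p => n /=; rewrite ?fV fX.
rewrite /subst_xt -/f (big_morph _ (free_evalM f) f1).
by apply: eq_bigr => i _; rewrite !conjgE !free_evalM fV !fZ !free_eval_gen.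
Qed.

(** Each factor is a power of a conjugate of [gen_x] lying in [N], and emptiness of [S_w] makes the
    exponents of each conjugate cancel. By contraposition, [S_w] is nonempty for a value outside
    [N']. *)
Lemma expr_value_derived (E : expression) :
  (forall j, ~~ S_w E j) -> N' (expr_value E).
Proof.
move=> S0; have [Nsub NJ] := normal_closure_normal [set gen_x]%classic.
pose s := [seq (expr_m i, expr_d i) | i <- index_enum (ordinal (expr_len E))].
have -> : expr_value E = \prod_(a <- s) zexpg (gen_x ^ zexpg gen_t a.2) a.1.
  rewrite big_map; apply: eq_bigr => i _; exact: zexpg_conj.
apply: (prod_zexpg_derived (y := fun j => gen_x ^ zexpg gen_t j)) => // [j|j].
  by apply: NJ; apply: sub_normal_closure.
apply/eqP; move: (S0 j); rewrite negbK big_map.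
by congr (_ == _); apply: eq_bigl => i; rewrite inE.
Qed.

End Expressions.

(** * From a tidy word to a relation with natural exponents *)

Theorem theoremA (R : realType) (disp : Order.disp_t)
    (G : biOrderedGroupType disp) (h z : G)
    (h_neq1 : h <> 1%g) (z_neq1 : z <> 1%g)
    (w : F_xt) (E : expression) (wE : expresses E w) (w_tidy : tidy E)
    (w_hz : subst_xt w h z = 1%g) :
  exists a : R, 0 < a /\ root (map_poly intr (A_w E)) a.
Proof.
have [[_ nN'] tau_gt tau_lt] := w_tidy; set m := @expr_m E; set d := @expr_d E.
have S_ex : exists j, S_w E j.
  apply: contrapT => S0; apply: nN'; apply: expr_value_derived => j.
  by apply/negP => Sj; apply: S0; exists j.
have [Se _] := e_wP S_ex; have [Sd e_le] := d_wP S_ex.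
(* Tidiness confines every [d i] to the interval from [e_w E] to [d_w E], so the shifted exponents
   [k i] are naturals at most [D]. *)
have d_ge i : e_w E <= d i.
  rewrite leNgt; apply/negP => /tau_lt /setP/(_ i).
  by rewrite !inE eqxx.
have d_le i : d i <= d_w E.
  rewrite leNgt; apply/negP => /tau_gt /setP/(_ i).
  by rewrite !inE eqxx.
pose k i := `|d i - e_w E|%N.
have kE i : (k i)%:Z = d i - e_w E by rewrite gez0_abs // subr_ge0.
pose D := `|d_w E - e_w E|%N.
have DE : D%:Z = d_w E - e_w E by rewrite gez0_abs // subr_ge0 e_le.
have kD i : (k i <= D)%N by rewrite -lez_nat kE DE lerD2r.
have sum0 : \sum_(i | k i == 0%N) m i != 0.
  rewrite -[X in X != _](_ : \sum_(i in tau E (e_w E)) m i = _) //.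
  by apply: eq_bigl => i; rewrite inE -eqz_nat kE subr_eq0.
have sumD : \sum_(i | k i == D) m i != 0.
  rewrite -[X in X != _](_ : \sum_(i in tau E (d_w E)) m i = _) //.
  by apply: eq_bigl => i; rewrite inE -eqz_nat kE DE (inj_eq (addIr _)).
have prod1 : (\prod_i zexpg (h ^ (z ^+ k i)) (m i) = 1)%g.
  have := w_hz; rewrite wE.2 subst_expr_value.
  (* Conjugating by this power of [z] shifts every [d i] to [k i]. *)
  move/(congr1 (fun u => u ^ zexpg z (- e_w E)))%g.
  rewrite conj1g conjg_prod => prodE; rewrite -[RHS]prodE.
  by apply: eq_bigr => i _; rewrite -conjgM -zexpgD zexpg_conj -kE.
suff [a a_gt0 root_a] :
    exists2 a : R, 0 < a & \sum_i (m i)%:~R * a ^+ k i = 0.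
  exists a; split=> //.
  rewrite rootE /A_w rmorph_sum horner_sum -[X in _ == X]root_a.
  apply/eqP; apply: eq_bigr => i _.
  by rewrite /= map_polyZ map_polyXn hornerZ hornerXn.
have [h1|h1|h1] := ltgtP h 1%g; last by case: h_neq1.
(* For [h] below 1, replacing [h] by its inverse and negating all [m i] keeps the relation and only
   changes the sign of the polynomial. *)
- have hV : (1%g < h^-1%g)%O by rewrite -invg1 ltg_inv.
  have [|||a a_gt0 sum_a] :=
    conjugation_root R (z := z) (m := fun i => - m i) hV kD.
  + by rewrite sumrN oppr_eq0.
  + by rewrite sumrN oppr_eq0.
  + rewrite -[RHS]prod1; apply: eq_bigr => i _.
    by rewrite zexpgN conjVg zexpVg invgK.
  exists a => //; apply: oppr_inj; rewrite oppr0 -[RHS]sum_a -sumrN.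
  by apply: eq_bigr => i _; rewrite rmorphN mulNr.
- exact: conjugation_root prod1.
Qed.
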